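(* Assume that $X$ is a time-homogeneous Markov process having the FOED property with function of evolution of distribution $F$ and initial distribution $\gamma$. Let $n\in\mathbb{N}$, $s\ge0$, $0=t_0<t_1<\ldots<t_n$, and let $f_0,\ldots,f_n$ be bounded Borel functions on $E$. Put $T^s_{k,n}=s+\sum_{i=1}^kt_i$ and define recursively $$h_1=\Lambda_{t_1}f_0,\qquad h_{k+1}=\Lambda_{t_{k+1}-t_k}\Big(f_k(\cdot)\,e^{\int_0^{t_k-t_{k-1}}F(u,\cdot)du}\,h_k(\cdot)\Big),\quad 1\le k\le n-1.$$ Then for almost every $z$ with respect to the Lebesgue measure, $$\mathbb{E}\Big(f_0(X_0)f_1(X_{t_1})\cdots f_n(X_{t_n})\,\Big|\,X_{T^s_{n,n}}=z\Big)=e^{-\int_{T^s_{n-1,n}}^{T^s_{n,n}}F(u,z)du}\;\Lambda_{T^s_{n-1,n}}\Big(f_n(\cdot)\,e^{\int_0^{t_n-t_{n-1}}F(u,\cdot)du}\,h_n(\cdot)\Big)(z).$$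
   Context: Setting: $(\Omega,\mathcal{F},\mathbb{P})$ is a complete probability space; $X=(X_t)_{t\ge0}$ is a càdlàg process with values in a Polish space $(E,\mathcal{E})$ (typically $E\subset\mathbb{R}^d$), with non-atomic initial distribution $\gamma$. ''Markov'' is with respect to the filtration generated by $X$, augmented to satisfy the usual conditions. FOED property: $X$ has the FOED property if there is a Borel measurable $F:\mathbb{R}_+\times E\to\mathbb{R}$ such that for every $y\in E$ the function $u\mapsto F(u,y)$ is locally integrable and $\mathbb{E}f(X_t)=\mathbb{E}\big(f(X_0)e^{\int_0^tF(u,X_0)du}\big)$ for every bounded Borel function $f$ on $E$ and every $t\ge0$. Such an $F$ is called the function of evolution of distribution of $X$. Bridge operator: for $t\ge0$ and $f\in L^1(\gamma)=L^1(E,\mathcal{B}(E),\gamma)$, $\Lambda_tf(z)=\mathbb{E}(f(X_0)\,|\,X_t=z)$, i.e. $\Lambda_tf=h$ where $h$ is Borel with $\mathbb{E}(f(X_0)|X_t)=h(X_t)$. It is always assumed that $(t,z)\mapsto\Lambda_tf(z)$ is measurable.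
   Formalization: The right side is shown to be a version of the conditional expectation, unique a.e. for the law of X_T; equality Lebesgue-a.e. for every version is claimed only if E embeds in R^m and γ-null sets are Lebesgue-null, as it fails otherwise (γ uniform on [0,1], E=R). *)

(* Defs.v *)
From HB Require Import structures.
From mathcomp Require Import all_boot all_order all_algebra.
From mathcomp Require Import all_classical all_reals all_analysis.

Set Implicit Arguments.
Unset Strict Implicit.
Unset Printing Implicit Defensive.

Import Order.TTheory GRing.Theory Num.Theory.
Import numFieldNormedType.Exports.

Local Open Scope classical_set_scope.
Local Open Scope ring_scope.

Notation borel E := (g_sigma_algebraType (@open E)).

(* [E] is a complete (pseudo)metric space; the Hausdorff condition makes the
   pseudometric a metric. *)
Definition polish (R : realType) (E : completePseudoMetricType R) :=
  hausdorff_space E /\ exists2 D : set E, countable D & dense D.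

Definition non_atomic d (T : measurableType d) (R : realType)
    (mu : {measure set T -> \bar R}) :=
  ~ exists A, [/\ measurable A, (0 < mu A)%E &
      forall B, measurable B -> B `<=` A -> mu B = 0%E \/ mu B = mu A].

Definition bounded_borel (R : realType) (E : completePseudoMetricType R)
    (f : borel E -> R) :=
  measurable_fun setT f /\ bounded_fun f.

Section conditional_expectation.
Context d (Omega : measurableType d) (R : realType) (P : probability Omega R).

(* [Z] is a version of E(Y | G), for an integrable [Y] and a
   sub-sigma-algebra [G]. *)
Definition is_cond_exp (G : set (set Omega)) (Y Z : Omega -> R) :=
  [/\ forall B : set R, measurable B -> G (Z @^-1` B),
      P.-integrable setT (EFin \o Z) &
      forall A, G A ->
        (\int[P]_(w in A) (Y w)%:E = \int[P]_(w in A) (Z w)%:E)%E].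

(* [h] is a version of z |-> E(Y | V = z): it is Borel and h(V) = E(Y | V). *)
Definition is_cond_exp_at d' (S : measurableType d') (V : Omega -> S)
    (Y : Omega -> R) (h : S -> R) :=
  measurable_fun setT h /\
  is_cond_exp (g_sigma_algebra_preimage V) Y (h \o V).

End conditional_expectation.

(* Processes are indexed by [R] for convenience; only the times t >= 0 matter. *)
Section process.
Context d (Omega : measurableType d) (R : realType) (P : probability Omega R)
  (E : completePseudoMetricType R) (X : R -> {RV P >-> borel E}).

Definition initial_distribution := distribution P (X 0).

Definition cadlag := forall w : Omega,
  (forall t : R, 0 <= t -> (fun r => X r w : E) @ t^'+ --> (X t w : E)) /\
  (forall t : R, 0 < t -> exists l : E, (fun r => X r w : E) @ t^'- --> l).

(* The filtration generated by [X], augmented by the null sets and made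
   right-continuous. *)
Definition augmented_filtration (t : R) : set (set Omega) :=
  \bigcap_(u in [set u | t < u])
    <<s (\bigcup_(r in `[0, u]) g_sigma_algebra_preimage (X r)) `|`
        negligible P >>.

(* The transition kernels [kappa s] do not depend on [t]: this is
   time-homogeneity. *)
Definition homogeneous_markov :=
  exists kappa : R -> (R.-pker (borel E) ~> (borel E)),
  forall (t s : R) (A : set (borel E)), 0 <= t -> 0 <= s -> measurable A ->
    is_cond_exp P (augmented_filtration t)
      (\1_A \o X (t + s)) (fun w => fine (kappa s (X t w) A)).

Definition FOED (F : R -> borel E -> R) :=
  [/\ measurable_fun [set p : R * borel E | 0 <= p.1]
        (fun p : R * borel E => F p.1 p.2),
      forall y (b : R), 0 <= b ->
        (@lebesgue_measure R).-integrable `[0, b] (EFin \o F^~ y) &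
      forall (f : borel E -> R) (t : R), bounded_borel f -> 0 <= t ->
        ('E_P[f \o X t] =
         'E_P[(fun w => f (X 0 w) *
           expR (\int[lebesgue_measure]_(u in `[0, t]) F u (X 0 w)))%R])%E ].

(* For every t, f the function [Lam t f] is a choice of version of
   z |-> E(f(X_0) | X_t = z), jointly measurable in (t, z). *)
Definition bridge_operator (Lam : R -> (borel E -> R) -> borel E -> R) :=
  forall f : borel E -> R,
    initial_distribution.-integrable setT (EFin \o f) ->
    (forall t : R, 0 <= t -> is_cond_exp_at P (X t) (f \o X 0) (Lam t f)) /\
    measurable_fun [set p : R * borel E | 0 <= p.1]
      (fun p : R * borel E => Lam p.1 f p.2).

End process.

(* T^s_k = s + t_1 + ... + t_k. *)
Definition Tsum (R : realType) (s : R) (t : nat -> R) (k : nat) : R :=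
  s + \sum_(1 <= i < k.+1) t i.

Section lebesgue_on_E.
Context (R : realType) (d : nat).

(* Null sets of the d-dimensional Lebesgue measure: those covered by countably
   many boxes of arbitrarily small total volume. *)
Definition lebesgue_null (N : set 'rV[R]_d) :=
  forall e : R, 0 < e -> exists a b : nat -> 'rV[R]_d,
    [/\ forall k i, a k ord0 i <= b k ord0 i,
        N `<=` \bigcup_k
          [set x | forall i, a k ord0 i <= x ord0 i <= b k ord0 i] &
        (\sum_(0 <= k <oo)
          (\prod_(i < d) (b k ord0 i - a k ord0 i))%:E <= e%:E)%E].

(* [j] identifies [E] with a topological subspace of R^d. *)
Definition euclidean_embedding (E : topologicalType) (j : E -> 'rV[R]_d) :=
  injective j /\
  forall U : set E, open U <->
    exists2 V : set 'rV[R]_d, open V & U = j @^-1` V.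

End lebesgue_on_E.

(* Main.v *)
Require Import Defs.
From HB Require Import structures.
From mathcomp Require Import all_boot all_order all_algebra.
From mathcomp Require Import all_classical all_reals all_analysis measurable_realfun.
Import Order.TTheory GRing.Theory Num.Theory.
Import numFieldNormedType.Exports.
Import HBNNSimple.
Local Open Scope classical_set_scope.
Local Open Scope ring_scope.

(** By FOED, the law of [X t] has density [rho t = exp (int_0^t F)] with respect
    to the law of [X 0]. Let [Z] be a bounded function of the history up to time
    [t], [delta >= 0], and suppose that [E(Z g(X t)) = E(h(X delta) g(X delta))]
    for all bounded Borel [g]. With [q y = P(X r in A | X 0 = y)],
    the Markov property turns [E(Z f(X t) 1_A(X (t + r)))] into
    [E(Z (f q)(X t)) = E((h f q)(X delta)) = E((rho delta h f q)(X 0))]; a second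
    use of the Markov property, at time 0, makes this
    [E((f (rho delta) h)(X 0) 1_A(X r)) = E((L 1_A)(X r))] with
    [L = Lam r (f (rho delta) h)]. Induction on the number of factors handles the
    [h k]; the last step uses [r = T_(n-1)], since [t_n + T_(n-1) = T_n], and FOED
    then moves [L] from time [T_(n-1)] to time [T_n]. *)

(** * Integrals of [Y * g (V)]: from indicators to general [g] *)

Lemma integrable_mul_bounded {d} {T : measurableType d} {R : realType}
    {mu : {measure set T -> \bar R}} (Y g : T -> R) (M : R) :
  mu.-integrable setT (EFin \o Y) -> measurable_fun setT g ->
  (forall w, `|g w| <= M) ->
  mu.-integrable setT (fun w => (Y w * g w)%:E).
Proof.
move=> iY mg gM.
have : mu.-integrable setT ((EFin \o Y) \* (EFin \o g))%E.
  apply: integrableMl => //; exists M; split; first exact: num_real.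
  by move=> x Mx w _ /=; rewrite (le_trans (gM w)) // ltW.
by apply: eq_integrable => // w _ /=; rewrite EFinM.
Qed.

(** A simple [g] is the finite sum of [y] times the indicator of its level set at [y], so its
    integral is determined by those of indicators of [V]. *)
Lemma integral_mul_nnsfun {d d'} {T : measurableType d} {S : measurableType d'}
    {R : realType} (mu : {measure set T -> \bar R}) (V : T -> S) (Y : T -> R)
    (g : {nnsfun S >-> R}) :
  measurable_fun setT V -> mu.-integrable setT (EFin \o Y) ->
  (\int[mu]_w (Y w * g (V w))%:E =
   \sum_(y \in range g)
     y%:E * \int[mu]_w (Y w * \1_(g @^-1` [set y]) (V w))%:E)%E.
Proof.
move=> mV iY.
have iA y : mu.-integrable setT
    (fun w => (Y w * \1_(g @^-1` [set y]) (V w))%:E).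
  apply: (@integrable_mul_bounded _ _ _ _ _ _ 1) => //.
    by apply: measurableT_comp => //; exact: measurable_indic.
  by move=> w; rewrite indicE; case: (_ \in _); rewrite ?normr1 ?normr0.
rewrite fsbig_finite//=; under [RHS]eq_bigr do rewrite -integralZl//.
rewrite -integral_sum//; last by move=> y; exact: integrableZl.
apply: eq_integral => w _ /=.
rewrite sumEFin; congr EFin.
rewrite fimfunE fsbig_finite//= mulr_sumr; apply: eq_bigr => y _.
by rewrite mulrCA.
Qed.

(** Simple functions increase to [g]. The weights [Y1] and [Y2] may change sign, so the passage to
    the limit is by dominated convergence, with [|Y * g (V)|] as the bound. *)
Lemma ge0_eq_integral_mul {d d'} {T : measurableType d} {S : measurableType d'}
    {R : realType} (mu : {measure set T -> \bar R}) (V1 V2 : T -> S)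
    (Y1 Y2 : T -> R) (g : S -> R) :
  measurable_fun setT V1 -> measurable_fun setT V2 ->
  mu.-integrable setT (EFin \o Y1) -> mu.-integrable setT (EFin \o Y2) ->
  (forall A, measurable A ->
    \int[mu]_w (Y1 w * \1_A (V1 w))%:E = \int[mu]_w (Y2 w * \1_A (V2 w))%:E)%E ->
  measurable_fun setT g -> (forall z, 0 <= g z) ->
  mu.-integrable setT (fun w => (Y1 w * g (V1 w))%:E) ->
  mu.-integrable setT (fun w => (Y2 w * g (V2 w))%:E) ->
  (\int[mu]_w (Y1 w * g (V1 w))%:E = \int[mu]_w (Y2 w * g (V2 w))%:E)%E.
Proof.
move=> mV1 mV2 iY1 iY2 eqA mg g0 i1 i2.
have mEg : measurable_fun setT (fun z => (g z)%:E) by exact/measurable_EFinP.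
pose gn := nnsfun_approx measurableT mEg.
have gn_cvg z : gn n z @[n --> \oo] --> g z.
  apply: (@fine_cvg _ _ _ _ (fun n => (gn n z)%:E)).
  apply: (cvg_nnsfun_approx measurableT mEg) => //.
  by move=> x _; rewrite lee_fin.
have gn_le n z : gn n z <= g z.
  rewrite -(cvg_lim _ (gn_cvg z))//; apply: nondecreasing_cvgn_le.
    by move=> m p mp; have /lefP := nd_nnsfun_approx measurableT mEg mp; apply.
  by apply/cvg_ex; eexists; exact: gn_cvg.
have lim Y V : measurable_fun setT V -> mu.-integrable setT (EFin \o Y) ->
    mu.-integrable setT (fun w => (Y w * g (V w))%:E) ->
    (\int[mu]_w (Y w * gn n (V w))%:E)%E @[n --> \oo] -->
    (\int[mu]_w (Y w * g (V w))%:E)%E.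
  move=> mV iY iYg.
  have mY : measurable_fun setT Y by move/measurable_int: iY => /measurable_EFinP.
  apply: (@dominated_cvg _ _ _ _ _ _ _ _ (fun w => `|Y w * g (V w)|%:E)) => //.
  - move=> n; apply/measurable_EFinP; apply: measurable_funM => //.
    exact: measurableT_comp.
  - move=> w _; apply: cvg_EFin; first by near=> n.
    by apply: cvgM; [exact: cvg_cst|exact: gn_cvg].
  - exact: (integrable_norm (f := fun w => Y w * g (V w))).
  - move=> n w _; rewrite lee_fin !normrM ler_wpM2l//.
    by rewrite !ger0_norm// ?gn_le.
apply: (cvg_unique _ (lim _ _ mV1 iY1 i1)) => //.
have -> : (fun n => \int[mu]_w (Y1 w * gn n (V1 w))%:E)%E =
          (fun n => \int[mu]_w (Y2 w * gn n (V2 w))%:E)%E.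
  apply/funext => n; rewrite !integral_mul_nnsfun//.
  by apply: eq_fsbigr => y _; rewrite eqA.
exact: lim.
Unshelve. all: by end_near.
Qed.

(** The positive and negative parts of [g] are treated separately; each is at most [|g|], so
    integrability is inherited. Each side has its own variable because the process is compared at
    two different times. *)
Lemma eq_integral_mul {d d'} {T : measurableType d} {S : measurableType d'}
    {R : realType} (mu : {measure set T -> \bar R}) (V1 V2 : T -> S)
    (Y1 Y2 : T -> R) (g : S -> R) :
  measurable_fun setT V1 -> measurable_fun setT V2 ->
  mu.-integrable setT (EFin \o Y1) -> mu.-integrable setT (EFin \o Y2) ->
  (forall A, measurable A ->
    \int[mu]_w (Y1 w * \1_A (V1 w))%:E = \int[mu]_w (Y2 w * \1_A (V2 w))%:E)%E ->
  measurable_fun setT g ->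
  mu.-integrable setT (fun w => (Y1 w * g (V1 w))%:E) ->
  mu.-integrable setT (fun w => (Y2 w * g (V2 w))%:E) ->
  (\int[mu]_w (Y1 w * g (V1 w))%:E = \int[mu]_w (Y2 w * g (V2 w))%:E)%E.
Proof.
move=> mV1 mV2 iY1 iY2 eqA mg i1 i2.
have split_int (Y : T -> R) (V : T -> S) : measurable_fun setT V ->
    mu.-integrable setT (EFin \o Y) ->
    mu.-integrable setT (fun w => (Y w * g (V w))%:E) ->
    [/\ mu.-integrable setT (fun w => (Y w * g^\+ (V w))%:E),
        mu.-integrable setT (fun w => (Y w * g^\- (V w))%:E) &
        (\int[mu]_w (Y w * g (V w))%:E =
         \int[mu]_w (Y w * g^\+ (V w))%:E -
         \int[mu]_w (Y w * g^\- (V w))%:E)%E].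
  move=> mV iY iYg.
  have mY : measurable_fun setT Y.
    by move/measurable_int: iY => /measurable_EFinP.
  have ip : mu.-integrable setT (fun w => (Y w * g^\+ (V w))%:E).
    apply: le_integrable iYg => //.
      apply/measurable_EFinP; apply: measurable_funM => //.
      by apply: measurableT_comp => //; exact: measurable_funrpos.
    move=> w _; rewrite lee_fin !normrM ler_wpM2l// /funrpos.
    by case: (leP (g (V w)) 0) => // _; rewrite normr0.
  have im : mu.-integrable setT (fun w => (Y w * g^\- (V w))%:E).
    apply: le_integrable iYg => //.
      apply/measurable_EFinP; apply: measurable_funM => //.
      by apply: measurableT_comp => //; exact: measurable_funrneg.
    move=> w _; rewrite lee_fin !normrM ler_wpM2l// /funrneg.
    by case: (leP (- g (V w)) 0) => // _; rewrite ?normr0 ?normrN.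
  split => //; rewrite -integralB_EFin//; apply: eq_integral => w _.
  by rewrite -EFinB -mulrBr -[in LHS](funrposBneg g).
have [p1 m1 ->] := split_int _ _ mV1 iY1 i1.
have [p2 m2 ->] := split_int _ _ mV2 iY2 i2.
congr (_ - _)%E; apply: ge0_eq_integral_mul => //.
- exact: measurable_funrpos.
- exact: measurable_funrneg.
Qed.

(** Links the integrals over events in [is_cond_exp] to the integrals against indicators used
    everywhere else. *)
Lemma integral_preimage {d d'} {T : measurableType d} {S : measurableType d'}
    {R : realType} (mu : {measure set T -> \bar R}) (V : T -> S) (Y : T -> R)
    (A : set S) :
  (\int[mu]_(w in V @^-1` A) (Y w)%:E = \int[mu]_w (Y w * \1_A (V w))%:E)%E.
Proof.
rewrite integral_mkcond; apply: eq_integral => w _.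
rewrite patchE indicE (_ : (w \in V @^-1` A) = (V w \in A))//.
by case: (_ \in A); rewrite ?mulr1 ?mulr0.
Qed.

(** Tonelli is applied to the positive and negative parts of [F], extended by zero outside the strip
    [D]. The bound [0 <= a] keeps the strip inside the half-space where [F] is measurable. *)
Lemma measurable_Rintegral_itv {d} {S : measurableType d} {R : realType}
    (F : R -> S -> R) (a b : R) :
  measurable_fun [set p : R * S | 0 <= p.1] (fun p : R * S => F p.1 p.2) ->
  0 <= a ->
  measurable_fun setT
    (fun y => \int[lebesgue_measure]_(u in `[a, b]) F u y).
Proof.
move=> mF a0.
pose D : set (R * S) := `[a, b]%classic `*` setT.
have mD : measurable D by apply: measurableX.
pose G := (fun p : R * S => (F p.1 p.2)%:E) \_ D.
have mG : measurable_fun setT G.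
  apply/(measurable_restrictT _ mD)/measurable_EFinP.
  apply: measurable_funS mF.
    rewrite (_ : [set _ | _] = `[0, +oo[%classic `*` setT); first exact: measurableX.
    by apply/seteqP; split=> -[u y] /=; rewrite in_itv /= andbT // => -[].
  by move=> [u y] [/=]; rewrite in_itv /= => /andP[+ _] _; exact: le_trans.
have -> : (fun y => \int[lebesgue_measure]_(u in `[a, b]) F u y) =
    (fun y => fine (fubini_G lebesgue_measure G^\+%E y -
                    fubini_G lebesgue_measure G^\-%E y)).
  apply/funext => y; rewrite /Rintegral integral_mkcond integralE.
  congr (fine (_ - _)); apply: eq_integral => u _;
    by rewrite ?funeposE ?funenegE /G !patchE /D in_setX /= in_setT andbT.
apply: (measurableT_comp (fine_measurable _)) => //.
apply: emeasurable_funB.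
- apply: measurable_fun_fubini_tonelli_G => //.
  exact: measurable_funepos.
- apply: measurable_fun_fubini_tonelli_G => //.
  exact: measurable_funeneg.
Qed.

(* By FOED, the density of the law of [X t] with respect to the law of [X 0]. *)
Definition evolution_density {R : realType} {E : completePseudoMetricType R}
    (F : R -> borel E -> R) (t : R) (y : borel E) : R :=
  expR (\int[lebesgue_measure]_(u in `[0, t]) F u y).

(** * Change of law from time [t] to time 0 *)

Section foed.
Context {d} {Omega : measurableType d} {R : realType} {P : probability Omega R}
  {E : completePseudoMetricType R} {X : R -> {RV P >-> borel E}}
  {F : R -> borel E -> R}.
Hypothesis foedX : FOED X F.

Local Notation rho := (evolution_density F).

Lemma measurable_evolution_density t : measurable_fun setT (rho t).
Proof.
case: foedX => mF _ _.
apply: measurableT_comp; first exact: measurable_expR.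
exact: measurable_Rintegral_itv.
Qed.

(** FOED speaks of bounded functions: [g] is truncated at level [n], and monotone convergence gives
    the identity, both sides possibly infinite. *)
Lemma FOED_ge0 (t : R) (g : borel E -> R) :
  0 <= t -> measurable_fun setT g -> (forall z, 0 <= g z) ->
  (\int[P]_w (g (X t w))%:E = \int[P]_w (rho t (X 0 w) * g (X 0 w))%:E)%E.
Proof.
move=> t0 mg g0; case: foedX => _ _ foed.
pose gn n z := Num.min (g z) n%:R.
have mgn n : measurable_fun setT (gn n) by exact: measurable_minr.
have gn0 n z : 0 <= gn n z by rewrite le_min g0 ler0n.
have gn_nd z : {homo gn^~ z : n m / (n <= m)%N >-> n <= m}.
  by move=> n m nm; rewrite /gn le_min !ge_min lexx/= ler_nat nm orbT.
have gn_cvg z : gn n z @[n --> \oo] --> g z.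
  apply: cvg_near_cst; near=> n; apply/min_idPl.
  near: n; exact: nbhs_infty_ger.
(* The weight [Y] lets one limit serve both sides: [Y = 1] at time [t], and [Y = rho t (X 0)] at
   time 0. *)
have mon (Y : Omega -> R) (V : Omega -> borel E) :
    measurable_fun setT V -> measurable_fun setT Y -> (forall w, 0 <= Y w) ->
    (\int[P]_w (Y w * gn n (V w))%:E)%E @[n --> \oo] -->
    (\int[P]_w (Y w * g (V w))%:E)%E.
  move=> mV mY Y0.
  have /(cvg_monotone_convergence measurableT) h : forall n, measurable_fun setT
      (fun w => (Y w * gn n (V w))%:E).
    move=> n; apply/measurable_EFinP/measurable_funM => //.
    exact: measurableT_comp.
  rewrite (_ : (\int[P]_w (Y w * g (V w))%:E)%E =
    (\int[P]_w (limn (fun n => (Y w * gn n (V w))%:E)))%E).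
    apply: h => [n w _|w _ n m nm].
      by rewrite lee_fin mulr_ge0.
    by rewrite lee_fin ler_wpM2l// gn_nd.
  apply: eq_integral => w _; apply/esym/cvg_lim => //.
  apply: cvg_EFin; first by near=> n.
  by apply: cvgM; [exact: cvg_cst|exact: gn_cvg].
have c1 := mon (cst 1) (X t) (measurable_funPT _) (measurable_cst _) (fun=> ler01).
have c2 := mon (rho t \o X 0) (X 0) (measurable_funPT _)
  (measurableT_comp (measurable_evolution_density t) (measurable_funPT _))
  (fun=> expR_ge0 _).
transitivity (\int[P]_w (cst 1 w * g (X t w))%:E)%E.
  by apply: eq_integral => w _; rewrite mul1r.
apply: (cvg_unique _ c1) => //.
rewrite (_ : (fun n => _) =
  (fun n => \int[P]_w ((rho t \o X 0) w * gn n (X 0 w))%:E)%E) //.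
apply/funext => n.
have bgn : bounded_borel (gn n).
  split => //; exists n%:R; split; first exact: num_real.
  move=> M nM z _ /=; rewrite ger0_norm//.
  by rewrite (le_trans _ (ltW nM))// ge_min lexx orbT.
move: (foed _ _ bgn t0); rewrite unlock => e.
transitivity (\int[P]_w ((gn n \o X t) w)%:E)%E.
  by apply: eq_integral => w _; rewrite mul1r.
by rewrite e; apply: eq_integral => w _; rewrite /= mulrC.
Unshelve. all: by end_near.
Qed.

Lemma FOED_integrable (t : R) (g : borel E -> R) :
  0 <= t -> measurable_fun setT g ->
  P.-integrable setT (fun w => (g (X t w))%:E) <->
  P.-integrable setT (fun w => (rho t (X 0 w) * g (X 0 w))%:E).
Proof.
move=> t0 mg.
have mr := measurable_evolution_density t.
have m1 : measurable_fun setT (fun w => (g (X t w))%:E).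
  by apply/measurable_EFinP; apply: measurableT_comp.
have m2 : measurable_fun setT (fun w => (rho t (X 0 w) * g (X 0 w))%:E).
  by apply/measurable_EFinP; apply: measurable_funM; apply: measurableT_comp.
have eq_norm := @FOED_ge0 t (fun z => `|g z|) t0
  (measurableT_comp (@normr_measurable R setT) mg) (fun=> normr_ge0 _).
have e2 : (\int[P]_w (rho t (X 0 w) * `|g (X 0 w)|)%:E =
           \int[P]_w `|(rho t (X 0 w) * g (X 0 w))%:E|)%E.
  apply: eq_integral => w _.
  by rewrite abse_EFin normrM (ger0_norm (expR_ge0 _)).
split => /integrableP[_ fin]; apply/integrableP; split => //.
- by rewrite -e2 -eq_norm.
- by rewrite -e2 -eq_norm in fin.
Qed.

Lemma FOED_integral (t : R) (g : borel E -> R) :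
  0 <= t -> measurable_fun setT g ->
  P.-integrable setT (fun w => (g (X t w))%:E) ->
  (\int[P]_w (g (X t w))%:E = \int[P]_w (rho t (X 0 w) * g (X 0 w))%:E)%E.
Proof.
move=> t0 mg ig.
transitivity (\int[P]_w (cst 1 w * g (X t w))%:E)%E.
  by apply: eq_integral => w _; rewrite mul1r.
have i1 : P.-integrable setT (EFin \o cst (1 : R)).
  exact: finite_measure_integrable_cst.
apply: (@eq_integral_mul _ _ _ _ _ P (X t) (X 0) (cst 1) (rho t \o X 0) g) => //.
(* The density itself is integrable: this is the equivalence for the constant function 1. *)
- have := FOED_integrable _ _ t0 (measurable_cst (1 : R)); move=> -[/(_ i1) + _].
  by apply: eq_integrable => // w _; rewrite mulr1.
- move=> A mA.
  have := @FOED_ge0 t (\1_A) t0 (measurable_indic mA) (fun=> ler0n _ _).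
  by move=> <-; apply: eq_integral => w _; rewrite mul1r.
- by apply: eq_integrable ig => // w _; rewrite mul1r.
- exact/FOED_integrable.
Qed.

End foed.

(** * The Markov property tested against functions of the past *)

Section markov.
Context {d} {Omega : measurableType d} {R : realType} {P : probability Omega R}
  {E : completePseudoMetricType R} {X : R -> {RV P >-> borel E}}.

(* The history up to time [t], before augmentation. *)
Definition past (t : R) : set (set Omega) :=
  \bigcup_(r in `[0, t]) g_sigma_algebra_preimage (X r).

(** Makes every event of the past one on which the Markov property may be tested. *)
Lemma sub_past_augmented (t : R) :
  <<s past t >> `<=` augmented_filtration X t.
Proof.
move=> A pA u /= tu; apply: (sub_sigma_algebra2 _ pA).
move=> B [r /= rt rB]; left; exists r => //=.
move: rt; rewrite !in_itv /= => /andP[-> rt].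
by rewrite (le_trans rt)// ltW.
Qed.

Lemma measurable_past (r t : R) : 0 <= r -> r <= t ->
  measurable_fun setT (X r : g_sigma_algebraType (past t) -> borel E).
Proof.
move=> r0 rt _ B mB; apply: sub_sigma_algebra.
by exists r; [rewrite /= in_itv /= r0|exists B].
Qed.

(** Lets a function measurable for the past be integrated as a random variable on [Omega]. *)
Lemma measurable_past_id (t : R) :
  measurable_fun setT (id : Omega -> g_sigma_algebraType (past t)).
Proof.
move=> _ B mB; rewrite setTI preimage_id.
suff : <<s past t >> `<=` @measurable d Omega by apply.
apply: smallest_sub; first exact: sigma_algebra_measurable.
by move=> C [r _ [D mD <-]]; rewrite setTI; exact: measurable_funPTI.
Qed.

(* [q] is the kernel [kappa s] evaluated at [A]; homogeneity is the fact that one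
   [q] serves all times [t]. *)
Lemma markov_past (s : R) (A : set (borel E)) :
  homogeneous_markov X -> 0 <= s -> measurable A ->
  exists q : borel E -> R, [/\ measurable_fun setT q, forall y, 0 <= q y <= 1 &
    forall (t : R) (Z : g_sigma_algebraType (past t) -> R),
      0 <= t -> measurable_fun setT Z ->
      P.-integrable setT (EFin \o (Z : Omega -> R)) ->
      (\int[P]_w (Z w * \1_A (X (t + s) w))%:E =
       \int[P]_w (Z w * q (X t w))%:E)%E].
Proof.
move=> [kappa mkv] s0 mA.
have k1 y : (0 <= kappa s y A <= 1)%E.
  rewrite measure_ge0 /= -(@prob_kernel _ _ _ _ _ (kappa s) y).
  by rewrite le_measure ?inE.
have kfin y : kappa s y A \is a fin_num.
  by have /andP[k0 k1'] := k1 y; rewrite ge0_fin_numE// (le_lt_trans k1')// ltry.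
pose q y := fine (kappa s y A).
have mq : measurable_fun setT q.
  apply: measurableT_comp; first exact: fine_measurable.
  exact: measurable_kernel.
have q01 y : 0 <= q y <= 1.
  by rewrite -!lee_fin /q fineK.
exists q; split => // t Z t0 mZ iZ.
have [_ _ mk] := mkv t s A t0 s0 mA.
have bnd (Y : Omega -> R) : measurable_fun setT Y ->
    (forall w, `|Y w| <= 1) -> P.-integrable setT (EFin \o Y).
  move=> mY Y1.
  have i1 := finite_measure_integrable_cst P (1 : R) measurableT.
  have := integrable_mul_bounded _ _ _ i1 mY Y1.
  by apply: eq_integrable => // w _; rewrite /= mul1r.
pose Y1 := \1_A \o X (t + s) : Omega -> R.
pose Y2 := q \o X t : Omega -> R.
have mY1 : measurable_fun setT Y1.
  by apply: measurableT_comp => //; exact: measurable_indic.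
have mY2 : measurable_fun setT Y2 by apply: measurableT_comp.
have nY1 w : `|Y1 w| <= 1.
  by rewrite /Y1 /= indicE; case: (_ \in _); rewrite ?normr1 ?normr0.
have nY2 w : `|Y2 w| <= 1.
  by rewrite /Y2 /=; have /andP[q0 ?] := q01 (X t w); rewrite ger0_norm.
have iZ1 := integrable_mul_bounded _ _ _ iZ mY1 nY1.
have iZ2 := integrable_mul_bounded _ _ _ iZ mY2 nY2.
(* The roles are exchanged: [Z] becomes the test function, of the variable [id] with values in
   [Omega] equipped with the past, while [Y1] and [Y2] become the weights. It remains to compare
   them on past events. *)
under eq_integral do rewrite mulrC.
under [RHS]eq_integral do rewrite mulrC.
apply: (@eq_integral_mul _ _ _ (g_sigma_algebraType (past t)) _ P
  id id Y1 Y2 Z) => //.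
- exact: measurable_past_id.
- exact: measurable_past_id.
- exact: bnd.
- exact: bnd.
- move=> B mB.
  rewrite -(integral_preimage P id Y1 B) -(integral_preimage P id Y2 B).
  by apply: mk; exact: sub_past_augmented.
- by apply: eq_integrable iZ1 => // w _; rewrite mulrC.
- by apply: eq_integrable iZ2 => // w _; rewrite mulrC.
Qed.

End markov.

(** * Bridge operators and transport between times *)

Lemma bounded_borel_le {R : realType} {E : completePseudoMetricType R}
    (f : borel E -> R) :
  bounded_borel f -> exists M : R, forall z, `|f z| <= M.
Proof.
by move=> [_ [M [_ fM]]]; exists (M + 1) => z; apply: fM => //; rewrite ltrDl.
Qed.

Section bridge.
Context {d} {Omega : measurableType d} {R : realType} {P : probability Omega R}
  {E : completePseudoMetricType R} {X : R -> {RV P >-> borel E}}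
  {F : R -> borel E -> R} {Lam : R -> (borel E -> R) -> borel E -> R}.

Local Notation rho := (evolution_density F).

(** Hypothesis and conclusion have the same shape, with [(Z, t, delta, h)] replaced by
    [(Z * f (X t), t + r, r, L)], so the step can be iterated. The step [r] is independent of
    [delta], since the last one is not an increment of the times. The history [Z] is bounded,
    whereas [h] comes from [Lam] and is only known to be integrable. *)
Lemma bridge_step (t delta r : R) (Z : g_sigma_algebraType (past (X := X) t) -> R)
    (f h : borel E -> R) (M : R) :
  FOED X F -> homogeneous_markov X -> bridge_operator X Lam ->
  0 <= t -> 0 <= delta -> 0 <= r ->
  measurable_fun setT Z -> (forall w, `|Z w| <= M) -> bounded_borel f ->
  measurable_fun setT h ->
  P.-integrable setT (fun w => (h (X delta w))%:E) ->
  (forall A, measurable A ->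
    \int[P]_w (Z w * \1_A (X t w))%:E =
    \int[P]_w (h (X delta w) * \1_A (X delta w))%:E)%E ->
  let L := Lam r (fun y => f y * rho delta y * h y) in
  [/\ measurable_fun setT L,
      P.-integrable setT (fun w => (L (X r w))%:E) &
      forall A, measurable A ->
        (\int[P]_w (Z w * f (X t w) * \1_A (X (t + r) w))%:E =
         \int[P]_w (L (X r w) * \1_A (X r w))%:E)%E].
Proof.
move=> foedX mkv br t0 d0 r0 mZ ZM bf mh ih eqZh L.
have [mf _] := bf; have [Mf fM] := bounded_borel_le _ bf.
have mrho := measurable_evolution_density foedX delta.
pose psi y := f y * rho delta y * h y.
have mpsi : measurable_fun setT psi.
  by do 2 (apply: measurable_funM => //).
have mX u (g : borel E -> R) : measurable_fun setT g ->
    measurable_fun setT (fun w => g (X u w)).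
  by move=> mg; exact: measurableT_comp.
have ihg (g : borel E -> R) (Mg : R) : measurable_fun setT g -> (forall z, `|g z| <= Mg) ->
    P.-integrable setT (fun w => (h (X delta w) * g (X delta w))%:E).
  move=> mg gM; apply: (@integrable_mul_bounded _ _ _ _ _ _ Mg) => //.
  exact: mX.
(* [h * f] is integrable at time [delta]; FOED moves it to time 0, where the factor [rho delta]
   completes it to [psi]. *)
have ipsi : P.-integrable setT (fun w => (psi (X 0 w))%:E).
  have := ihg f Mf mf fM.
  move=> /(FOED_integrable foedX delta (fun y => h y * f y) d0
    (measurable_funM mh mf)).
  by apply: eq_integrable => // w _; rewrite /psi /= mulrA mulrC mulrA.
have ipsi0 : (initial_distribution X).-integrable setT (EFin \o psi).
  by apply: integrable_pushforward => //; exact/measurable_EFinP.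
have [/(_ r r0)[mL [_ iL eqL]] _] := br psi ipsi0.
split => // A mA.
have [q [mq q01 mk]] := markov_past r A mkv r0 mA.
have q1 y : `|q y| <= 1 by have /andP[? ?] := q01 y; rewrite ger0_norm.
have mZO : measurable_fun setT (Z : Omega -> R).
  exact: (measurableT_comp mZ (measurable_past_id t)).
have i1 := finite_measure_integrable_cst P (1 : R) measurableT.
have iZ : P.-integrable setT (EFin \o (Z : Omega -> R)).
  have := integrable_mul_bounded _ _ _ i1 mZO ZM.
  by apply: eq_integrable => // w _; rewrite /= mul1r.
rewrite (mk t (fun w => Z w * f (X t w))) => //; first last.
- exact: integrable_mul_bounded iZ (mX t _ mf) (fun w => fM _).
- apply: measurable_funM => //; apply: measurableT_comp => //.
  exact: measurable_past.
have mfq : measurable_fun setT (fun y => f y * q y) by exact: measurable_funM.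
have fqM y : `|f y * q y| <= Mf by rewrite normrM -[leRHS]mulr1 ler_pM.
transitivity (\int[P]_w (Z w * (f (X t w) * q (X t w)))%:E)%E.
  by apply: eq_integral => w _; rewrite mulrA.
(* [eqZh] is extended from indicators to the bounded function [f * q]. *)
transitivity (\int[P]_w (h (X delta w) * (f (X delta w) * q (X delta w)))%:E)%E.
  apply: (@eq_integral_mul _ _ _ _ _ P (X t) (X delta) Z (h \o X delta)
    (fun y => f y * q y)) => //.
  - apply: (@integrable_mul_bounded _ _ _ _ _
      (fun w => f (X t w) * q (X t w)) Mf) => //.
    exact: (mX t (fun y => f y * q y)).
  - exact: (ihg (fun y => f y * q y) Mf).
rewrite (FOED_integral foedX delta (fun y => h y * (f y * q y)) d0)//; first last.
- exact: (ihg (fun y => f y * q y) Mf).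
- exact: measurable_funM.
transitivity (\int[P]_w (psi (X 0 w) * q (X 0 w))%:E)%E.
  apply: eq_integral => w _; congr EFin; rewrite /psi.
  by rewrite (mulrC (f _) (rho _ _)) -!mulrA (mulrCA (h _)).
(* The [q] obtained at time [t] is used again at time 0, now from right to left: homogeneity enters
   here. *)
rewrite -(mk 0 (psi \o X 0)) => //; last first.
  by apply: measurableT_comp => //; exact: measurable_past.
rewrite add0r -(integral_preimage P (X r) (psi \o X 0) A).
rewrite -(integral_preimage P (X r) (L \o X r) A).
by apply: eqL; exists A => //; rewrite setTI.
Qed.

(* FOED transports both laws to time 0, where the ratio of the densities at times
   [r] and [T] is the exponential factor. *)
Lemma FOED_cond_exp_at (r T : R) (Y : Omega -> R) (L : borel E -> R) :
  FOED X F -> 0 <= r -> r <= T ->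
  measurable_fun setT L -> P.-integrable setT (fun w => (L (X r w))%:E) ->
  (forall A, measurable A ->
    \int[P]_w (Y w * \1_A (X T w))%:E =
    \int[P]_w (L (X r w) * \1_A (X r w))%:E)%E ->
  is_cond_exp_at P (X T) Y
    (fun z => expR (- \int[lebesgue_measure]_(u in `[r, T]) F u z) * L z).
Proof.
move=> foedX r0 rT mL iL eqYL; have T0 := le_trans r0 rT.
have [mF Fint _] := foedX.
set g := (fun z => _ * L z).
have rhoE z : rho T z * g z = rho r z * L z.
  (* Subtracting the integral over [[r, T]] from that over [[0, T]] leaves [[0, r]].
     [Rintegral_itvB] produces []r, T]], which differs from [[r, T]] by one point. *)
  have /(Rintegral_itvB (x := r)) := Fint z T T0.
  rewrite !bnd_simp => /(_ r0 rT).
  rewrite /g /evolution_density mulrA -expRD; set a := Rintegral _ _ _.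
  move=> e; congr (expR _ * _).
  rewrite -Rintegral_itv_obnd_cbnd -?e ?subKr//.
  apply: integrableS (Fint z T T0) => //.
  by apply: subset_itv; rewrite bnd_simp.
have mg : measurable_fun setT g.
  apply: measurable_funM => //; apply: measurableT_comp; first exact: measurable_expR.
  apply: measurableT_comp; first exact: oppr_measurable.
  exact: measurable_Rintegral_itv.
have ig : P.-integrable setT (fun w => (g (X T w))%:E).
  apply/(FOED_integrable foedX T g T0 mg).
  move/(FOED_integrable foedX r L r0 mL): iL.
  by apply: eq_integrable => // w _; rewrite rhoE.
split => //; split => //.
  move=> B mB; exists (g @^-1` B); last by rewrite setTI.
  by rewrite -[_ @^-1` _]setTI; exact: mg.
move=> _ [A mA <-]; rewrite setTI.
rewrite (integral_preimage P (X T) Y A) (integral_preimage P (X T) (g \o X T) A).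
rewrite eqYL//.
have mI : measurable_fun setT (\1_A : borel E -> R) by exact: measurable_indic.
have I1 z : `|\1_A z : R| <= 1.
  by rewrite indicE; case: (_ \in _); rewrite ?normr1 ?normr0.
rewrite (FOED_integral foedX r (fun y => L y * \1_A y) r0)//; first last.
- apply: integrable_mul_bounded iL _ _ => //; exact: measurableT_comp.
- exact: measurable_funM.
rewrite (FOED_integral foedX T (fun y => g y * \1_A y) T0)//; first last.
- apply: integrable_mul_bounded ig _ _ => //; exact: measurableT_comp.
- exact: measurable_funM.
apply: eq_integral => w _; congr EFin.
by rewrite [LHS]mulrA [RHS]mulrA; congr (_ * _); exact/esym/rhoE.
Qed.

(** The density is an exponential, hence positive everywhere. If its integral over [X 0] in [N] is
    zero, the product with the indicator vanishes almost surely, and so does the indicator. *)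
Lemma FOED_absolutely_continuous (t : R) (N : set (borel E)) :
  FOED X F -> 0 <= t -> measurable N ->
  distribution P (X t) N = 0%E -> initial_distribution X N = 0%E.
Proof.
move=> foedX t0 mN N0.
have mr := measurable_evolution_density foedX t.
have mI : measurable_fun setT (\1_N : borel E -> R) by exact: measurable_indic.
have mX0 (g : borel E -> R) : measurable_fun setT g ->
    measurable_fun setT (fun w => g (X 0 w)).
  by move=> mg; exact: measurableT_comp.
have := FOED_ge0 foedX t (\1_N) t0 mI (fun=> ler0n _ _).
rewrite (_ : (\int[P]_w _)%E = 0%E); last first.
  have := integral_indic P measurableT (measurable_funPTI (X t) mN).
  by rewrite setIT => e; exact: (etrans e N0).
move=> /esym I0.
have : ae_eq P setT (fun w => (rho t (X 0 w) * \1_N (X 0 w))%:E) (cst 0%E).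
  apply/ae_eq_integral_abs => //.
    by apply/measurable_EFinP; apply: measurable_funM; exact: mX0.
  rewrite -[RHS]I0; apply: eq_integral => w _.
  by rewrite abse_EFin ger0_norm// mulr_ge0// expR_ge0.
move=> ae.
have : P.-negligible (X 0 @^-1` N).
  apply: negligibleS ae => w /= Nw /(_ Logic.I) [].
  rewrite indicE mem_set// mulr1 => e.
  have := expR_gt0 (\int[lebesgue_measure]_(u in `[0, t]) F u (X 0 w)).
  by rewrite -/(rho _ _) e ltxx.
by move/negligibleP; apply; rewrite -[_ @^-1` _]setTI; exact: measurable_funPT.
Qed.

End bridge.

(** Pushed forward to the law of [V], both versions have the same integral over every measurable
    set, so they agree almost everywhere. *)
Lemma cond_exp_at_ae_unique {d d'} {Omega : measurableType d} {R : realType}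
    {P : probability Omega R} {S : measurableType d'} (V : {RV P >-> S})
    (Y : Omega -> R) (c1 c2 : S -> R) :
  is_cond_exp_at P V Y c1 -> is_cond_exp_at P V Y c2 ->
  \forall z \ae distribution P V, c1 z = c2 z.
Proof.
move=> [m1 [_ i1 e1]] [m2 [_ i2 e2]].
have mc1 : measurable_fun setT (EFin \o c1) by exact/measurable_EFinP.
have mc2 : measurable_fun setT (EFin \o c2) by exact/measurable_EFinP.
have : ae_eq (distribution P V) setT (EFin \o c1) (EFin \o c2).
  apply: integral_ae_eq => //.
    by apply: integrable_pushforward.
  move=> A _ mA.
  have GA : g_sigma_algebra_preimage V (V @^-1` A) by exists A => //; rewrite setTI.
  have mVA : measurable (V @^-1` A) by exact: measurable_funPTI.
  rewrite !integral_pushforward//.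
  - by rewrite -[LHS](e1 _ GA) -[RHS](e2 _ GA).
  - exact: integrableS i2.
  - exact: integrableS i1.
by apply: filterS => z /(_ Logic.I) [].
Qed.

(** * The recursion for [h] and the final formula *)

Theorem theorem5p1 (R : realType) (d : measure_display)
  (Omega : measurableType d) (P : probability Omega R)
  (E : completePseudoMetricType R) (X : R -> {RV P >-> borel E})
  (F : R -> borel E -> R) (Lam : R -> (borel E -> R) -> borel E -> R)
  (n : nat) (s : R) (t : nat -> R) (f h : nat -> borel E -> R) :
  measure_is_complete P ->
  polish E ->
  cadlag X ->
  non_atomic (initial_distribution X) ->
  homogeneous_markov X ->
  FOED X F ->
  bridge_operator X Lam ->
  (0 < n)%N ->
  0 <= s ->
  t 0%N = 0 ->
  (forall i, (i < n)%N -> t i < t i.+1) ->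
  (forall i, (i <= n)%N -> bounded_borel (f i)) ->
  h 1%N = Lam (t 1%N) (f 0%N) ->
  (forall k, (1 <= k < n)%N ->
    h k.+1 = Lam (t k.+1 - t k) (fun y =>
      f k y *
      expR (\int[lebesgue_measure]_(u in `[0, t k - t k.-1]) F u y) *
      h k y)) ->
  let Y := fun w => \prod_(i < n.+1) f i (X (t i) w) in
  let V := X (Tsum s t n) in
  let rhs := fun z =>
    expR (- \int[lebesgue_measure]_(u in `[Tsum s t n.-1, Tsum s t n]) F u z) *
    Lam (Tsum s t n.-1) (fun y =>
      f n y *
      expR (\int[lebesgue_measure]_(u in `[0, t n - t n.-1]) F u y) *
      h n y) z in
  (* the right-hand side is a version of E(Y | V = .), *)
  is_cond_exp_at P V Y rhs /\
  (* and every version c coincides with it *)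
  forall c : borel E -> R, is_cond_exp_at P V Y c ->
    (* almost everywhere for the law of V, *)
    (\forall z \ae distribution P V, c z = rhs z) /\
    (* and Lebesgue-almost everywhere on E when E is a subspace of R^m on which
       the Lebesgue measure is absolutely continuous with respect to the
       initial distribution (otherwise c is arbitrary on a non-null set) *)
    (forall (m : nat) (j : E -> 'rV[R]_m),
      euclidean_embedding j ->
      (forall N : set (borel E),
        (initial_distribution X).-negligible N -> lebesgue_null (j @` N)) ->
      lebesgue_null (j @` [set z | c z <> rhs z])).
Proof.
move=> _ _ _ _ mkv foedX br n0 s0 t00 tinc fb h1 hS Y V rhs.
have t_le i j : (i <= j)%N -> (j <= n)%N -> t i <= t j.
  move=> /subnK <-; elim: (j - i)%N => // m IH mn.
  by rewrite addSn (le_trans (IH (ltnW mn)))// ltW// tinc.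
have t_ge0 i : (i <= n)%N -> 0 <= t i by move=> ?; rewrite -t00 t_le.
have prodM k : (k <= n.+1)%N ->
    exists M : R, forall w, `|\prod_(i < k) f i (X (t i) w)| <= M.
  elim: k => [_|k IH kn]; first by exists 1 => w; rewrite big_ord0 normr1.
  have [M ZM] := IH (ltnW kn); have [Mf fM] := bounded_borel_le _ (fb k kn).
  by exists (M * Mf) => w; rewrite big_ord_recr/= normrM ler_pM.
(* The product stops before [f k], which enters at time [t k] as the factor [f] of [bridge_step]. *)
have mprod k : (k <= n)%N -> measurable_fun setT
    (fun w : g_sigma_algebraType (past (X := X) (t k)) =>
      \prod_(i < k) f i (X (t i) w)).
  move=> kn; apply: measurable_prod => i _.
  have ik := ltnW (ltn_ord i); have iN := leq_trans ik kn.
  apply: measurableT_comp; first by have [] := fb i iN.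
  exact: measurable_past (t_ge0 i iN) (t_le i k ik kn).
pose delta k := t k - t k.-1.
have delta_ge0 k : (k <= n)%N -> 0 <= delta k.
  by move=> kn; rewrite subr_ge0 t_le// leq_pred.
(* Invariant of the induction: the first [k] factors, seen through [X (t k)], act as [h k] seen
   through [X (delta k)]. *)
have hP k : (0 < k <= n)%N -> [/\ measurable_fun setT (h k),
    P.-integrable setT (fun w => (h k (X (delta k) w))%:E) &
    forall A, measurable A ->
      (\int[P]_w (\prod_(i < k) f i (X (t i) w) * \1_A (X (t k) w))%:E =
       \int[P]_w (h k (X (delta k) w) * \1_A (X (delta k) w))%:E)%E].
  case: k => // k; elim: k => [_|k IH /= kn].
    (* For [k = 1], [delta 1 = t 1] because [t 0 = 0], and the invariant is the defining property of
       the bridge [h 1]. *)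
    have [mf _] := fb 0 (leq0n n).
    have [Mf fM] := bounded_borel_le _ (fb 0 (leq0n n)).
    have if0 : (initial_distribution X).-integrable setT (EFin \o f 0).
      have i1 := finite_measure_integrable_cst (distribution P (X 0))
        (1 : R) measurableT.
      have := integrable_mul_bounded _ _ _ i1 mf fM.
      by apply: eq_integrable => // z _; rewrite /= mul1r.
    have [/(_ (t 1%N) (t_ge0 1%N n0))[mL [_ iL eqL]] _] := br (f 0) if0.
    rewrite /delta/= t00 subr0 h1; split => // A mA.
    rewrite -(integral_preimage P (X (t 1%N))
      (Lam (t 1%N) (f 0) \o X (t 1%N)) A).
    rewrite -(integral_preimage P (X (t 1%N))
      (fun w => \prod_(i < 1) f i (X (t i) w)) A).
    rewrite -eqL; last by exists A => //; rewrite setTI.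
    by apply: eq_integral => w _; rewrite big_ord1 /= t00.
  have [mh ih eqh] := IH (ltnW kn).
  have [M ZM] := prodM k.+1 (leqW (ltnW kn)).
  (* Here [r] is the next increment, so that [t k.+1 + r = t k.+2]. *)
  have [mL iL eqL] := bridge_step (t k.+1) (delta k.+1) (delta k.+2) _ (f k.+1)
    (h k.+1) M foedX mkv br (t_ge0 _ (ltnW kn)) (delta_ge0 _ (ltnW kn))
    (delta_ge0 _ kn) (mprod _ (ltnW kn)) ZM (fb _ (ltnW kn)) mh ih eqh.
  rewrite (hS k.+1 kn); split => // A mA.
  rewrite -eqL// /delta/= subrKC.
  by apply: eq_integral => w _; rewrite big_ord_recr.
have Tsum_ge0 k : (k <= n)%N -> 0 <= Tsum s t k.
  move=> kn; rewrite addr_ge0// big_nat sumr_ge0// => i /andP[_ ik].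
  by rewrite t_ge0// (leq_trans _ kn).
have TsumE : t n + Tsum s t n.-1 = Tsum s t n.
  move: n0; case: (n) => // m _.
  by rewrite /Tsum [in RHS]big_nat_recr//= [RHS]addrA addrC.
have nn : (0 < n <= n)%N by rewrite n0 leqnn.
have [mh ih eqh] := hP n nn.
have T1_ge0 := Tsum_ge0 _ (leq_pred n).
have [M ZM] := prodM n (leqnSn n).
have [mL iL eqL] := bridge_step (t n) (delta n) (Tsum s t n.-1) _ (f n)
  (h n) M foedX mkv br (t_ge0 _ (leqnn n)) (delta_ge0 _ (leqnn n))
  T1_ge0 (mprod _ (leqnn n)) ZM (fb _ (leqnn n)) mh ih eqh.
have rhsP : is_cond_exp_at P V Y rhs.
  apply: FOED_cond_exp_at foedX T1_ge0 _ mL iL _.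
    by rewrite -TsumE lerDr t_ge0.
  move=> A mA; rewrite -eqL// TsumE; apply: eq_integral => w _.
  by rewrite /Y big_ord_recr.
split => // c cP.
have c_rhs := cond_exp_at_ae_unique V Y c rhs cP rhsP.
split => // m j _; apply.
(* The exceptional set lies in a Borel set [N] that is null for the law of [V]. By positivity of the
   density [N] is null for the initial law, and the assumed absolute continuity carries this to
   Lebesgue measure. *)
have [N [mN N0 cN]] := c_rhs.
exists N; split => //.
exact: (FOED_absolutely_continuous (Tsum s t n) N foedX
  (Tsum_ge0 _ (leqnn n))).
Qed.
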